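(* Let $A$ be a circular $m\times n$ matrix and let $\Gamma$ be a circuit in $F(A)$ with winding number $p$. For each node $j\in[n]$ let $r(j)$ be the number of row arcs of $\Gamma$ that jump over $j$. Then $r(j)=p-1$ if $j\in\circ(\Gamma)$, $r(j)=p+1$ if $j\in\otimes(\Gamma)$, and $r(j)=p$ if $j\in\bullet(\Gamma)$.
   Context: Notation: $[n]=\{1,\dots,n\}$ with addition mod $n$ (index $0$ identified with $n$); for $a,c\in[n]$ with $t\ge0$ minimal such that $a+t\equiv c\pmod n$, $[a,c)_n=\{a,\dots,a+t-1\}$ (mod $n$). An $m\times n$ $\{0,1\}$-matrix $A$ is circular if for each row $i$ there are $\ell_i\in[n]$ and an integer $2\le k_i\le n-1$ with row $i$ the incidence vector of $[\ell_i,\ell_i+k_i)_n$. $F(A)$: digraph on $[n]$ (labels mod $n$) with row arcs $a_i=(\ell_i-1,\ell_i+k_i-1)$ ($i\in[m]$, length $k_i$), forward short arcs $(j-1,j)$ (length $1$) and reverse short arcs $(j,j-1)$ (length $-1$), $j\in[n]$. A circuit is a simple directed circuit; winding number $p(\Gamma)$: $p(\Gamma)n=$ sum of lengths of arcs of $\Gamma$. A row arc $a_i$ jumps over node $j$ iff $j\in[\ell_i,\ell_i+k_i)_n$. For a circuit $\Gamma$: $\circ(\Gamma)=\{j:(j-1,j)\in E(\Gamma)\}$, $\otimes(\Gamma)=\{j:(j,j-1)\in E(\Gamma)\}$, $\bullet(\Gamma)=[n]\setminus(\circ(\Gamma)\cup\otimes(\Gamma))$. *)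

(* Defs.v *)
From mathcomp Require Import all_boot all_order all_algebra.
Set Implicit Arguments. Unset Strict Implicit. Unset Printing Implicit Defensive.

(* Nodes of [n] = {1,...,n} are handled modulo n: the natural number x
   denotes the node x mod n (so 0 and n denote the same node n). *)

(* cyclic interval membership: j \in [a, a+k)_n  (for 0 <= k <= n) *)
Definition cint (n a k j : nat) : bool :=
  ((j %% n) + n - (a %% n)) %% n < k.

(* A is the m x n {0,1}-matrix whose row i is the incidence vector of
   [l_i, l_i + k_i)_n, with l_i in [n] and 2 <= k_i <= n-1.
   Column c : 'I_n corresponds to column index c+1 in [n]. *)
Definition circular_with (m n : nat) (A : 'M[nat]_(m, n))
    (l k : 'I_m -> nat) : Prop :=
  forall i : 'I_m,
    [/\ 1 <= l i <= n, 2 <= k i <= n.-1 &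
        forall c : 'I_n, A i c = nat_of_bool (cint n (l i) (k i) c.+1)].

(* Arcs of F(A): row farc a_i, forward short farc (j-1,j), reverse short farc
   (j,j-1), with j : 'I_n denoting node j mod n. *)
Inductive farc (m n : nat) : Type :=
| RowArc of 'I_m
| FwdArc of 'I_n
| RevArc of 'I_n.

Section Arcs.
Variables (m n : nat) (l k : 'I_m -> nat).

Definition atail (a : farc m n) : nat :=
  match a with
  | RowArc i => (l i).-1 %% n
  | FwdArc j => (j + n).-1 %% n
  | RevArc j => j %% n
  end.

Definition ahead (a : farc m n) : nat :=
  match a with
  | RowArc i => (l i + k i).-1 %% n
  | FwdArc j => j %% n
  | RevArc j => (j + n).-1 %% n
  end.

Definition alen (a : farc m n) : int :=
  match a with
  | RowArc i => (k i)%:Z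
  | FwdArc _ => 1%R
  | RevArc _ => (-1)%R
  end.

Definition circuit (c : seq (farc m n)) : bool :=
  [&& 0 < size c,
      cycle (fun a b => ahead a == atail b) c &
      uniq (map atail c)].

Definition isFwd (j : 'I_n) (a : farc m n) : bool :=
  if a is FwdArc j' then j' == j else false.
Definition isRev (j : 'I_n) (a : farc m n) : bool :=
  if a is RevArc j' then j' == j else false.

Definition in_circ (c : seq (farc m n)) (j : 'I_n) : bool := has (isFwd j) c.
Definition in_otimes (c : seq (farc m n)) (j : 'I_n) : bool := has (isRev j) c.

Definition total_length (c : seq (farc m n)) : int :=
  (\sum_(a <- c) alen a)%R.

Definition jumps (j : 'I_n) (a : farc m n) : bool :=
  if a is RowArc i then cint n (l i) (k i) j else false.

Definition rjump (c : seq (farc m n)) (j : 'I_n) : nat := count (jumps j) c.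

End Arcs.

(* Main.v *)
Require Import Defs.
From mathcomp Require Import all_boot all_order all_algebra.
From mathcomp Require Import zify.

Set Implicit Arguments.
Unset Strict Implicit.
Unset Printing Implicit Defensive.

(* Fix a node j and give each node x in {0, ..., n-1} the potential
   n [j <= x] - x.  Along an arc of length d from t to h = t + d (mod n) the
   potential changes by n c - d, where c is the signed number of passes of
   the arc over j: +1 for a row arc jumping over j and for the forward arc
   (j-1, j), -1 for the reverse arc (j, j-1).  Around a circuit the potential
   telescopes, so the signed count r(j) + [j in circ] - [j in otimes] equals
   the total length divided by n, i.e. p.  Since a circuit visits each node
   once, it uses at most one of the two short arcs at j, and the three cases
   follow. *)

Lemma modn_lt_double (n x : nat) : x < n + n -> x %% n = if x < n then x else x - n.
Proof.
move=> lt_x2n; case: ltnP => [/modn_small -> // | le_nx].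
by rewrite -{1}(subnK le_nx) modnDr modn_small //; lia.
Qed.

Lemma cint1 (n a j : nat) : 0 < n -> cint n a 1 j = (j %% n == a %% n).
Proof.
move=> n_gt0; rewrite /cint ltnS leqn0.
have := ltn_pmod j n_gt0; have := ltn_pmod a n_gt0.
move: (j %% n) (a %% n) => x y lt_yn lt_xn.
rewrite modn_lt_double; last by lia.
by case: ifP => ?; apply/eqP/eqP => ?; lia.
Qed.

Lemma cint_succ_step (n t d j : nat) : t < n -> j < n -> d <= n ->
  n * cint n t.+1 d j + n * (j <= t) + (t + d) %% n =
  n * (j <= (t + d) %% n) + t + d.
Proof.
move=> lt_tn lt_jn le_dn; rewrite /cint (modn_small lt_jn).
rewrite (@modn_lt_double n (t + d)); last by lia.
case: (ltnP t.+1 n) => [lt_t1n | le_nt1].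
- rewrite (modn_small lt_t1n) modn_lt_double; last by lia.
  by do 2 case: ifP => ?; rewrite /nat_of_bool; repeat case: ifP => ?; lia.
- have -> : t.+1 = n by lia.
  rewrite modnn subn0 modnDr (modn_small lt_jn).
  by case: ifP => ?; rewrite /nat_of_bool; repeat case: ifP => ?; lia.
Qed.

Import GRing.Theory.
Local Open Scope ring_scope.

Lemma sum_nat_of_bool_count (T : Type) (P : pred T) (s : seq T) :
  \sum_(a <- s) (P a)%:Z = (count P s)%:Z.
Proof. by elim: s => [|a s IHs]; rewrite ?big_nil ?big_cons ?IHs //= PoszD. Qed.

Lemma count_le1_uniq_map (T : Type) (X : eqType) (f : T -> X) (P : pred T)
    (x : X) (s : seq T) :
  uniq (map f s) -> (forall a, P a -> f a = x) -> (count P s <= 1)%N.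
Proof.
move=> uniq_fs Pf; apply: (@leq_trans (count_mem x (map f s))).
  by rewrite count_map; apply: sub_count => a /Pf /= ->.
by rewrite count_uniq_mem ?leq_b1.
Qed.

Lemma cycle_telescope (T : Type) (X : eqType) (V : zmodType)
    (tl hd : T -> X) (F : X -> V) (s : seq T) :
  cycle (fun a b => hd a == tl b) s -> \sum_(a <- s) (F (hd a) - F (tl a)) = 0.
Proof.
case: s => [|x s]; first by rewrite big_nil.
have path_telescope y r : path (fun a b => hd a == tl b) y r ->
    \sum_(a <- y :: r) (F (hd a) - F (tl a)) = F (hd (last y r)) - F (tl y).
  elim: r y => [|z r IHr] y /=; first by rewrite big_seq1.
  by case/andP => /eqP hd_y /IHr; rewrite big_cons => ->; rewrite hd_y addrC addrA subrK.
rewrite /= rcons_path => /andP[/path_telescope sum_xs /eqP hd_last].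
by rewrite sum_xs hd_last subrr.
Qed.

Section Crossings.
Variables (m n : nat) (l k : 'I_m -> nat).
Hypotheses (l_range : forall i, (0 < l i <= n)%N) (k_le : forall i, (k i <= n)%N).
Variable j : 'I_n.

Definition potential (x : nat) : int := (n * (j <= x))%:Z - x%:Z.

Lemma potential_step (t d : nat) : (t < n)%N -> (d <= n)%N ->
  n%:Z * (cint n t.+1 d j)%:Z = potential ((t + d) %% n) - potential t + d%:Z.
Proof.
move=> lt_tn le_dn; have := cint_succ_step lt_tn (ltn_ord j) le_dn.
rewrite /potential; lia.
Qed.

Lemma potential_pred_step (x : 'I_n) :
  n%:Z * (x == j)%:Z = potential x - potential ((x + n).-1 %% n) + 1.
Proof.
have n_gt0 : (0 < n)%N by apply: leq_ltn_trans (ltn_ord x).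
set t := ((x + n).-1 %% n)%N.
have t_succ : ((t + 1) %% n)%N = x.
  by rewrite modnDml addn1 (prednK (ltn_addl _ n_gt0)) modnDr modn_small.
have := @potential_step t 1 (ltn_pmod _ n_gt0) n_gt0.
by rewrite t_succ cint1 // modn_small // -addn1 t_succ eq_sym.
Qed.

Definition crossings (a : farc m n) : int :=
  (jumps l k j a)%:Z + (isFwd j a)%:Z - (isRev j a)%:Z.

Lemma crossings_potential (a : farc m n) :
  n%:Z * crossings a = potential (ahead l k a) - potential (atail l a) + alen k a.
Proof.
rewrite /crossings; case: a => [i | x | x] /=.
- have /andP[l_gt0 le_ln] := l_range i.
  have lt_tn : ((l i).-1 < n)%N by lia.
  have := potential_step lt_tn (k_le i).
  have -> : (l i + k i).-1 = ((l i).-1 + k i)%N by lia.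
  by rewrite prednK // addr0 subr0 (modn_small lt_tn).
- by rewrite add0r subr0 (modn_small (ltn_ord x)) potential_pred_step.
- have := potential_pred_step x; rewrite (modn_small (ltn_ord x)); lia.
Qed.

Lemma total_length_crossings (c : seq (farc m n)) :
  cycle (fun a b => ahead l k a == atail l b) c ->
  n%:Z * \sum_(a <- c) crossings a = total_length k c.
Proof.
move=> cycle_c; rewrite mulr_sumr.
under eq_bigr do rewrite crossings_potential.
by rewrite big_split /= cycle_telescope // add0r.
Qed.

Lemma sum_crossings (c : seq (farc m n)) :
  \sum_(a <- c) crossings a =
  (rjump l k c j)%:Z + (count (isFwd j) c)%:Z - (count (isRev j) c)%:Z.
Proof. by rewrite !big_split sumrN /= !sum_nat_of_bool_count. Qed.

End Crossings.

Theorem lemma6p1 (m n : nat) (A : 'M[nat]_(m, n)) (l k : 'I_m -> nat)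
    (c : seq (farc m n)) (p : int) :
  circular_with A l k ->
  circuit l k c ->
  (* the degenerate 2-circuit {(j-1,j),(j,j-1)} is excluded (see NOTES) *)
  ~ (exists j : 'I_n, in_circ c j && in_otimes c j) ->
  total_length k c = (p * n%:Z)%R ->
  forall j : 'I_n,
    [/\ in_circ c j -> (rjump l k c j)%:Z = (p - 1)%R,
        in_otimes c j -> (rjump l k c j)%:Z = (p + 1)%R &
        ~~ in_circ c j -> ~~ in_otimes c j -> (rjump l k c j)%:Z = p].
Proof.
move=> circA /and3P[_ cycle_c uniq_tails] not_both total_c j.
have l_range i : (0 < l i <= n)%N by case: (circA i) => /andP[-> ->].
have k_le i : (k i <= n)%N by case: (circA i) => _ /andP[_ ?] _; lia.
have n_neq0 : n%:Z != 0 by have := ltn_ord j; lia.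
have sum_p : \sum_(a <- c) crossings l k j a = p.
  by apply: (mulfI n_neq0); rewrite total_length_crossings // total_c mulrC.
have fwd_le1 : (count (isFwd j) c <= 1)%N.
  by apply: (count_le1_uniq_map (x := ((j + n).-1 %% n)%N) uniq_tails); case=> // x /eqP ->.
have rev_le1 : (count (isRev j) c <= 1)%N.
  by apply: (count_le1_uniq_map (x := (j %% n)%N) uniq_tails); case=> // x /eqP ->.
have not_both_j : ~~ (in_circ c j && in_otimes c j) by apply/negP => ?; apply: not_both; exists j.
move: sum_p not_both_j; rewrite sum_crossings /in_circ /in_otimes !has_count.
by split; lia.
Qed.
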